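(* Let $D=(d_1,\dots,d_n)$ be a nonincreasing sequence of positive integers, with even sum $\sum_{i=1}^n d_i$ and $d_n<n-1$. Let $w=\min\{i\ge 1 \mid i\ge d_{i+2}\}$. For $k\in[1..n]$ let $(\mathrm{B}_k)$ denote the inequality $$\sum_{i=1}^k d_i\le\sum_{i=1}^k\bar d_i .$$ The following are equivalent: (1) $D$ is graphic. (2) $(\mathrm{B}_k)$ holds for all $k\in[w+1..n]$. (3) The TopRight algorithm applied to $D$ returns True. (4) $(\mathrm{B}_k)$ holds for $k=w+1$ and for each right weak index $k$ of $D$.
   Context: $[a..b]$ denotes the set of integers $k$ with $a\le k\le b$. A sequence of positive integers is graphic if it is the degree sequence of a simple graph. Corrected conjugates: $\bar d_i=|\{j\mid 1\le j<i,\ j\le n,\ d_j\ge i-1\}|+|\{j\mid i<j\le n,\ d_j\ge i\}|$ (in particular $\bar d_i=0$ for $i>d_1+1$). Convention: $d_j=0$ for $j>n$. An index $i\in[1..n]$ is a weak index of $D$ if $i\ge d_{i+2}$; it is a right weak index if moreover $d_i>d_{i+1}$. (Since $d_n<n-1$, $n-2$ is a weak index, so $w$ is well defined.) TopRight algorithm, with input $D$: the sequence $D$ is modified but never reordered, $w$ stays fixed at the value computed from the input sequence, and zeros (which occur only at the right end) are systematically removed, so that $|D|$ decreases. At any moment, $d_{top}$ denotes the integer of the current $D$ with largest value and, among those, smallest index; $right=|D|$, so $d_{right}$ is the rightmost integer of the current $D$. While $d_{top}\le|D|-1$ and $d_{top}>w$: subtract 1 from $d_{top}$ and 1 from $d_{right}$,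 and remove zeros at the end. When the loop stops, return the truth value of $(d_{top}=w)$. *)

(* Defs.v *)
From mathcomp Require Import all_boot.

Set Implicit Arguments.
Unset Strict Implicit.
Unset Printing Implicit Defensive.

(** [dseq D j] is d_j: indices start at 1 and d_j = 0 beyond the end of D.
    The value at j = 0 is meaningless and never used. *)
Definition dseq (D : seq nat) (j : nat) : nat := nth 0 D j.-1.

Definition simple_graph (T : finType) (e : rel T) : Prop :=
  symmetric e /\ irreflexive e.

Definition degree (T : finType) (e : rel T) (x : T) : nat :=
  #|[set y | e x y]|.

Definition graphic (D : seq nat) : Prop :=
  exists (T : finType) (e : rel T),
    simple_graph e /\ perm_eq [seq degree e x | x : T] D.

Definition corrected_conj (D : seq nat) (i : nat) : nat :=
  count (fun j => (j < i) && (i - 1 <= dseq D j)) (iota 1 (size D)) +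
  count (fun j => (i < j) && (i <= dseq D j)) (iota 1 (size D)).

Definition ineqB (D : seq nat) (k : nat) : Prop :=
  \sum_(1 <= i < k.+1) dseq D i <= \sum_(1 <= i < k.+1) corrected_conj D i.

Definition weak_index (D : seq nat) (i : nat) : bool :=
  (1 <= i <= size D) && (dseq D (i + 2) <= i).

Definition right_weak_index (D : seq nat) (i : nat) : bool :=
  weak_index D i && (dseq D (i + 1) < dseq D i).

Lemma ex_min_weak (D : seq nat) :
  exists i, (1 <= i) && (dseq D (i + 2) <= i).
Proof.
exists (size D).+1; rewrite /dseq nth_default //.
by rewrite addn2 ltnW.
Qed.

Definition min_weak (D : seq nat) : nat := ex_minn (ex_min_weak D).

(** List positions ([top_pos], [right_pos]) count from 0; [index] returns the
    leftmost position of the maximum. *)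

Definition top_pos (s : seq nat) : nat := index (\max_(x <- s) x) s.

Definition top_val (s : seq nat) : nat := nth 0 s (top_pos s).

Definition right_pos (s : seq nat) : nat := (size s).-1.

Definition decr_nth (s : seq nat) (i : nat) : seq nat :=
  set_nth 0 s i (nth 0 s i - 1).

(** Removes the zeros at the right end only. *)
Definition strip_zeros (s : seq nat) : seq nat :=
  foldr (fun x t => if (x == 0) && nilp t then [::] else x :: t) [::] s.

Definition topright_guard (w : nat) (s : seq nat) : bool :=
  (top_val s <= size s - 1) && (w < top_val s).

Definition topright_body (s : seq nat) : seq nat :=
  strip_zeros (decr_nth (decr_nth s (top_pos s)) (right_pos s)).

(** Big-step semantics of the while loop: [topright_loop w s b] means that the
    loop started in state [s] terminates and then returns [b]. *)
Inductive topright_loop (w : nat) : seq nat -> bool -> Prop :=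
| TopRightStop s :
    ~~ topright_guard w s -> topright_loop w s (top_val s == w)
| TopRightIter s b :
    topright_guard w s -> topright_loop w (topright_body s) b ->
    topright_loop w s b.

Definition topright_returns (D : seq nat) (b : bool) : Prop :=
  topright_loop (min_weak D) D b.

(* Main.v *)
(** Write d_1 >= ... >= d_n and w = min_weak D.  Counting the corrected conjugates
    row by row turns (B_k) into
      sum_{j <= k} max(d_j - (k-1), 0) <= sum_{j > k} min(d_j, k),
    which double counting of edges proves for any graph.  For k > w every d_j with
    j > k is at most k, so the right side is just a tail sum; in this form a step
    of TopRight, which lowers the top entry and the last entry by one, neither
    creates nor destroys a violated inequality with k > w, and when the loop stops
    all of them hold exactly if the top entry is w.

    Conversely a successful run produces a graph.  Its final state has w + 1
    entries equal to w and all others at most w: it is realized from a clique on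
    the former by raising the other degrees two units at a time.  The run is then
    undone step by step.  Both use the same move: if x is not adjacent to a and
    deg x > deg b, then x has a neighbour y outside the neighbourhood of b, and
    replacing xy by ax and by raises the degrees of a and b. *)

Require Import Defs.
From mathcomp Require Import all_boot.
From mathcomp Require Import zify.

Set Implicit Arguments.
Unset Strict Implicit.
Unset Printing Implicit Defensive.

(** * Realizing degree functions *)

(** Degrees are prescribed vertex by vertex, so single vertices can be modified without permuting a
    sequence. *)
Definition realizable (T : finType) (f : T -> nat) : Prop :=
  exists e : rel T, simple_graph e /\ forall x, degree e x = f x.

(** One involution serves both to insert and to delete the edge ab. *)
Definition flip (T : eqType) (a b : T) (e : rel T) : rel T :=
  fun x y => e x y (+) ((x == a) && (y == b) || (x == b) && (y == a)).

Section Graphs.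
Variable T : finType.
Implicit Types (e : rel T) (a b x y : T) (f g : T -> nat).

Lemma degreeE e x : degree e x = \sum_y e x y.
Proof.
rewrite /degree -sum1dep_card big_mkcond.
by apply: eq_bigr => y _; case: (e x y).
Qed.

Lemma flipK a b e : flip a b (flip a b e) =2 e.
Proof. by move=> x y; rewrite /flip addbK. Qed.

Lemma flip_simple a b e : a != b -> simple_graph e -> simple_graph (flip a b e).
Proof.
move=> ab [sym irr]; split=> [x y|x].
  by rewrite /flip sym (orbC (_ && _)) (andbC (y == a)) (andbC (y == b)).
rewrite /flip irr; apply/negbTE/negP => /orP[] /andP[/eqP xa /eqP xb];
  by rewrite -xa -xb eqxx in ab.
Qed.

Lemma degree_flip_add a b e x : a != b -> simple_graph e -> ~~ e a b ->
  degree (flip a b e) x = degree e x + (x == a) + (x == b).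
Proof.
move=> ab [sym irr] eab.
have sum_pred1 (c : bool) (d : T) : \sum_y (c && (y == d) : nat) = c.
  rewrite (bigD1 d) //= eqxx andbT big1 ?addn0 // => y /negbTE->.
  by rewrite andbF.
rewrite !degreeE -[in RHS](sum_pred1 (x == a) b) -(sum_pred1 (x == b) a).
rewrite -!big_split; apply: eq_bigr => y _ /=; rewrite /flip.
have [xa|xa] := eqVneq x a; have [yb|yb] := eqVneq y b => //=.
- by rewrite xa yb (negbTE eab) (negbTE ab).
- by rewrite xa (negbTE ab) addbF !addn0.
- have [xb|xb] := eqVneq x b => /=; last by rewrite addbF !addn0.
  by rewrite yb eq_sym (negbTE ab) addbF !addn0.
have [xb|xb] := eqVneq x b => /=; last by rewrite addbF !addn0.
have [ya|ya] := eqVneq y a => /=; last by rewrite addbF !addn0.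
by rewrite xb ya sym (negbTE eab).
Qed.

Lemma degree_flip_del a b e x : a != b -> simple_graph e -> e a b ->
  degree (flip a b e) x + (x == a) + (x == b) = degree e x.
Proof.
move=> ab es eab; rewrite -degree_flip_add //.
- by rewrite !degreeE; apply: eq_bigr => y _; rewrite flipK.
- exact: flip_simple.
by rewrite /flip eab !eqxx.
Qed.

(** An edge between x and b counts once in both degrees, so the neighbours of x other than b still
    outnumber the neighbours of b other than x. *)
Lemma neighbor_outside e b x : simple_graph e -> degree e b < degree e x ->
  exists y, [/\ e x y, y != b & ~~ e b y].
Proof.
move=> [sym irr] lt_bx.
have xb : x != b by apply: contraTneq lt_bx => ->; rewrite ltnn.
suff /subsetPn[y] : ~~ ([set y | e x y] :\ b \subset [set y | e b y] :\ x).
  rewrite !inE => /andP[yb exy] ney; exists y; split=> //.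
  apply: contraNN ney => ->; rewrite andbT.
  by apply: contraTneq exy => ->; rewrite irr.
apply: contraTN lt_bx => /subset_leq_card; rewrite -leqNgt /degree.
rewrite (cardsD1 b [set y | e x y]) (cardsD1 x [set y | e b y]) !inE sym.
by rewrite leq_add2l.
Qed.

(** The edge move of the overview. The vertices a and b may coincide; that degree is then raised by
    two. *)
Lemma realizable_raise e a b x f : simple_graph e -> x != a -> ~~ e a x ->
    degree e b < degree e x ->
    (forall z, f z = degree e z + (z == a) + (z == b)) ->
  realizable f.
Proof.
move=> es xa eax lt_bx fE.
have [y [exy yb eby]] := neighbor_outside es lt_bx.
have [sym irr] := es.
have xb : x != b by apply: contraTneq lt_bx => ->; rewrite ltnn.
have ya : y != a by apply: contraNneq eax => <-; rewrite sym.
have xy : x != y by apply: contraTneq exy => ->; rewrite irr.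
have ax : a != x by rewrite eq_sym.
have b_neq_y : b != y by rewrite eq_sym.
have s1 := flip_simple xy es.
have s2 := flip_simple ax s1.
have e1ax : ~~ flip x y e a x.
  by rewrite /flip (negbTE eax) (negbTE ax) (eq_sym a) (negbTE ya).
have e2by : ~~ flip a x (flip x y e) b y.
  rewrite /flip (negbTE eby) !(eq_sym b) (negbTE xb) (negbTE yb) (negbTE ya) /=.
  by rewrite (eq_sym y) (negbTE xy) andbF.
exists (flip b y (flip a x (flip x y e))); split; first exact: flip_simple.
move=> z; rewrite fE degree_flip_add // degree_flip_add //.
by rewrite -(degree_flip_del z xy es exy) [LHS](ACl (1*3*5*2*4)).
Qed.

Lemma realizable_eq f g : f =1 g -> realizable f -> realizable g.
Proof. by move=> fg [e [es eg]]; exists e; split=> // x; rewrite eg fg. Qed.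

Lemma realizable_edge e a b f : simple_graph e -> a != b -> ~~ e a b ->
    (forall z, f z = degree e z + (z == a) + (z == b)) ->
  realizable f.
Proof.
move=> es ab eab fE; exists (flip a b e); split; first exact: flip_simple.
by move=> x; rewrite degree_flip_add // fE.
Qed.

Lemma nonneighbor_in (A : {set T}) e a : simple_graph e ->
    degree e a + (a \in A) < #|A| ->
  exists x, [/\ x \in A, x != a & ~~ e a x].
Proof.
move=> [sym irr]; rewrite (cardsD1 a A) [in X in X -> _]addnC ltn_add2l => ltA.
have /subsetPn[x] : ~~ (A :\ a \subset [set y | e a y]).
  by apply: contraTN ltA => /subset_leq_card; rewrite -leqNgt.
by rewrite !inE => /andP[xa xA] eax; exists x.
Qed.

(** Undoes one TopRight step. In a graph for g, t has f t - 1 neighbours, too few to cover the other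
    vertices with f positive; let x be one that is missed. If x = r, insert the edge tr; otherwise
    minimality of f r gives deg r < deg x and the move applies. *)
Lemma realizable_top_right f g t r :
    t != r -> f t < #|[set x | 0 < f x]| -> (forall x, 0 < f x -> f r <= f x) ->
    (forall x, f x = g x + (x == t) + (x == r)) ->
  realizable g -> realizable f.
Proof.
move=> tr ft minr fE [e [es eg]].
have fE' x : f x = degree e x + (x == t) + (x == r) by rewrite eg.
have [] := @nonneighbor_in [set x | 0 < f x] e t es.
  by move: ft; rewrite inE (fE' t) eqxx (negbTE tr); lia.
move=> x; rewrite inE => -[fx xt etx].
have [xr|xr] := eqVneq x r.
  by apply: (realizable_edge es tr) => //; rewrite -xr.
apply: (realizable_raise es xt etx _ fE').
move: (minr x fx); rewrite !fE' (negbTE xr) (negbTE xt) eqxx eq_sym (negbTE tr).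
lia.
Qed.

Lemma realizable_clique (A : {set T}) w : #|A| = w.+1 ->
  realizable (fun x => w * (x \in A)).
Proof.
move=> cA; exists (fun x y => [&& x \in A, y \in A & x != y]); split.
  by split=> [x y|x] /=; rewrite ?eqxx ?andbF // eq_sym andbCA.
move=> x; rewrite /degree; case: (boolP (x \in A)) => xA /=; last first.
  by rewrite muln0; apply/eqP; rewrite cards_eq0; apply/eqP/setP => y; rewrite !inE.
rewrite muln1; have := cardsD1 x A; rewrite cA xA add1n => -[->].
by apply: eq_card => y; rewrite !inE eq_sym andbC.
Qed.

(** Induction on the total degree outside A, two units at a time. A vertex a outside A has at most w
    neighbours, so it misses some x in A, whose degree w exceeds that of b. *)
Lemma realizable_saturated (A : {set T}) w f : #|A| = w.+1 ->
    (forall x, x \in A -> f x = w) -> (forall x, f x <= w) ->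
    ~~ odd (\sum_x f x) ->
  realizable f.
Proof.
move=> cA fA fw.
have sumA (h : T -> nat) : (forall x, x \in A -> h x = w) ->
    \sum_x h x = w * w.+1 + \sum_(x | x \notin A) h x.
  move=> hA; rewrite (bigID [in A]) /= (eq_bigr (fun=> w)) //.
  by rewrite sum_nat_const cA mulnC.
have [m] := ubnP (\sum_(x | x \notin A) f x).
elim: m f fA fw => // m IH f fA fw; rewrite sumA // oddD oddM /= andbN /=.
have [S0|] := posnP (\sum_(x | x \notin A) f x); last first.
  rewrite lt0n sum_nat_eq0 => /forallPn[a].
  rewrite negb_imply -lt0n => /andP[aA fa].
  have [g fE] : exists g, forall x, f x = g x + (x == a).
    by exists (fun x => f x - (x == a)) => x; rewrite subnK //; case: eqP => // ->.
  have -> : \sum_(x | x \notin A) f x = (\sum_(x | x \notin A) g x).+1.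
    rewrite (eq_bigr _ (fun x _ => fE x)) big_split /= -addn1; congr (_ + _).
    by rewrite (bigD1 a) //= eqxx big1 // => x /andP[_ /negbTE->].
  rewrite ltnS /= negbK => Sm Sodd.
  (* As w(w+1) is even, so is the sum outside A: after one unit is taken at a, another remains at
     some b, possibly a again. *)
  have : 0 < \sum_(x | x \notin A) g x by case: (\sum_(x | _) _) Sodd.
  rewrite lt0n sum_nat_eq0 => /forallPn[b].
  rewrite negb_imply -lt0n => /andP[bA gb].
  have [h gE] : exists h, forall x, g x = h x + (x == b).
    by exists (fun x => g x - (x == b)) => x; rewrite subnK //; case: eqP => // ->.
  have fhE x : f x = h x + (x == a) + (x == b) by rewrite fE gE addnAC.
  have hA x : x \in A -> h x = w.
    move=> xA; rewrite -(fA x xA) fhE.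
    have [xa|_] := eqVneq x a; first by rewrite -xa xA in aA.
    have [xb|_] := eqVneq x b; first by rewrite -xb xA in bA.
    by rewrite !addn0.
  have Sg : \sum_(x | x \notin A) g x = (\sum_(x | x \notin A) h x).+1.
    rewrite (eq_bigr _ (fun x _ => gE x)) big_split /= -addn1; congr (_ + _).
    by rewrite (bigD1 b) //= eqxx big1 // => x /andP[_ /negbTE->].
  have [x|||e [es eh]] := IH h hA.
  - by apply: leq_trans (fw x); rewrite fhE -addnA leq_addr.
  - by apply: leq_trans Sm; rewrite Sg.
  - rewrite sumA // oddD oddM /= andbN /=.
    by rewrite Sg /= in Sodd.
  have [|x [xA xa eax]] := @nonneighbor_in A e a es.
    rewrite (negbTE aA) addn0 cA eh ltnS (leq_trans _ (fw a)) //.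
    by rewrite fhE -addnA leq_addr.
  apply: (realizable_raise es xa eax (b := b)).
    rewrite !eh (hA x) // (leq_trans _ (fw b)) //.
    by rewrite fhE eqxx addn1 ltnS leq_addr.
  by move=> z; rewrite eh fhE.
move/eqP: S0; rewrite sum_nat_eq0 => /forallP f0 _ _.
apply: realizable_eq (realizable_clique cA) => x.
case: (boolP (x \in A)) => xA; first by rewrite muln1 fA.
by have := f0 x; rewrite xA muln0 => /eqP.
Qed.

End Graphs.

(** * The inequalities (B_k) *)

(** Counts the edges leaving A: x in A has at most #|A| - 1 neighbours inside A, and y outside
    receives at most min(deg y, #|A|). *)
Lemma sum_degree_excess (T : finType) (e : rel T) (A : {set T}) :
    simple_graph e ->
  \sum_(x in A) (degree e x - #|A|.-1)
    <= \sum_(x | x \notin A) minn (degree e x) #|A|.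
Proof.
move=> [sym irr].
apply: (@leq_trans (\sum_(x in A) \sum_(y | y \notin A) e x y)).
  apply: leq_sum => x xA; rewrite degreeE (bigID [in A]) /= leq_subLR leq_add2r.
  rewrite (bigD1 x) //= irr add0n (cardsD1 x A) xA -sum1_card.
  rewrite (eq_bigl (fun y => y \in A :\ x)); last by move=> y; rewrite !inE andbC.
  by apply: leq_sum => y _; case: (e x y).
rewrite exchange_big; apply: leq_sum => y yA; rewrite leq_min; apply/andP; split.
  rewrite degreeE [leqRHS](bigID [in A]) /= (leq_trans _ (leq_addr _ _)) //.
  by apply: leq_sum => x _; rewrite sym.
by rewrite -sum1_card; apply: leq_sum => x _; case: (e x y).
Qed.

Lemma sum_take (F : nat -> nat) (s : seq nat) k : k <= size s ->
  \sum_(x <- take k s) F x = \sum_(0 <= i < k) F (nth 0 s i).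
Proof.
move=> ks; rewrite (big_nth 0) size_takel //.
by apply: eq_big_nat => i ik; rewrite nth_take.
Qed.

Lemma sum_drop (F : nat -> nat) (s : seq nat) k :
  \sum_(x <- drop k s) F x = \sum_(k <= i < size s) F (nth 0 s i).
Proof.
rewrite (big_nth 0) size_drop -[X in _ = \sum_(X <= _ < _) _]add0n big_addn.
by apply: eq_big_nat => i _; rewrite nth_drop addnC.
Qed.

Lemma graphic_sum_excess (D : seq nat) k : graphic D -> k <= size D ->
  \sum_(0 <= i < k) (nth 0 D i - k.-1)
    <= \sum_(k <= i < size D) minn (nth 0 D i) k.
Proof.
move=> [T [e [es]]]; rewrite perm_sym => /(perm_iotaP 0)[I permI ->].
have [x0 _|T0] := pickP [pred x : T | true]; last first.
  have -> : I = [::].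
    apply: perm_nilP; rewrite (perm_trans permI) // size_map enumT.
    by rewrite -enumT -cardE eq_card0.
  by case: k => // _; rewrite big_geq.
(* The vertices in the order of D; the first k of them will form A. *)
pose s := [seq nth x0 (enum T) i | i <- I].
have sE : [seq nth 0 [seq degree e x | x : T] i | i <- I] = map (degree e) s.
  rewrite -map_comp; apply/eq_in_map => i; rewrite (perm_mem permI).
  by rewrite mem_iota add0n size_map => /andP[_ iT] /=; rewrite (nth_map x0).
have perm_s : perm_eq s (enum T).
  rewrite -[X in perm_eq _ X](mkseq_nth x0) /mkseq perm_map //.
  by move: permI; rewrite size_map.
have uniq_s : uniq s by rewrite (perm_uniq perm_s) enum_uniq.
rewrite sE -(@sum_drop (minn^~ k)) size_map => ks.
rewrite -(@sum_take (fun x => x - k.-1)); last by rewrite size_map.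
rewrite -map_take -map_drop !big_map.
have := uniq_s; rewrite -[s in uniq s](cat_take_drop k) cat_uniq.
move=> /and3P[ut /hasPn dis ud].
pose A := [set x in take k s].
have cA : #|A| = k by rewrite cardsE (card_uniqP ut) size_takel.
have sumE (P : pred T) (r : seq T) F : uniq r -> P =i r ->
    \sum_(x <- r) F x = \sum_(x | P x) F x.
  by move=> ur Pr; rewrite big_uniq //; apply: eq_bigl => x; rewrite -Pr.
rewrite (sumE [in A]) //; last by move=> x; rewrite !inE.
rewrite (sumE [pred x | x \notin A]) //; last first.
  move=> x; have := perm_mem perm_s x; rewrite mem_enum -{1}(cat_take_drop k s).
  rewrite mem_cat !inE /=; case: (boolP (x \in drop k s)) => [/dis|_].
    by move=> /= /negbTE->.
  by rewrite orbF => ->.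
by have := sum_degree_excess A es; rewrite cA.
Qed.

Lemma corrected_conjE (D : seq nat) i :
  corrected_conj D i =
  \sum_(1 <= j < (size D).+1)
     (((j < i) && (i - 1 <= dseq D j)) + ((i < j) && (i <= dseq D j))).
Proof.
rewrite /corrected_conj big_split /= /index_iota subSS subn0.
by rewrite -!sum1_count; congr (_ + _); rewrite big_mkcond;
  apply: eq_bigr => j _; case: ifP.
Qed.

(** Row j + 1 of the corrected Ferrers diagram: its d dots are set from the left and skip the
    diagonal cell, so k - 1 of the first k cells are available if the diagonal is among them, and k
    otherwise. *)
Lemma corrected_row_sum (d j k : nat) :
  \sum_(1 <= i < k.+1) (((j.+1 < i) && (i - 1 <= d)) + ((i < j.+1) && (i <= d))) =
  minn d (k - (j < k)).
Proof.
elim: k => [|k IH]; first by rewrite big_geq // sub0n minn0.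
by rewrite big_nat_recr //= IH; lia.
Qed.

Lemma ineqBE (D : seq nat) k : k <= size D -> ineqB D k <->
  \sum_(0 <= i < k) (nth 0 D i - k.-1)
    <= \sum_(k <= i < size D) minn (nth 0 D i) k.
Proof.
move=> kD; rewrite /ineqB.
rewrite (eq_bigr _ (fun i _ => corrected_conjE D i)) exchange_big /=.
rewrite !big_add1 /= (eq_bigr _ (fun j _ => corrected_row_sum _ j k)).
rewrite (@big_cat_nat _ _ _ k _ (size D)) //=.
have -> : \sum_(0 <= j < k) minn (dseq D j.+1) (k - (j < k)) =
          \sum_(0 <= i < k) minn (nth 0 D i) k.-1.
  by apply: eq_big_nat => i /andP[_ ik]; rewrite ik subn1.
have -> : \sum_(k <= j < size D) minn (dseq D j.+1) (k - (j < k)) =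
          \sum_(k <= i < size D) minn (nth 0 D i) k.
  by apply: eq_big_nat => i /andP[ki _]; rewrite ltnNge ki subn0.
(* This splitting of d_i cancels the minima of the first k rows. *)
rewrite (eq_bigr (fun i => minn (nth 0 D i) k.-1 + (nth 0 D i - k.-1))).
  by rewrite big_split leq_add2l.
by move=> i _; rewrite /dseq /=; lia.
Qed.

(** * The TopRight loop *)

Implicit Types s : seq nat.

Lemma nth_decr s p i : nth 0 (decr_nth s p) i = nth 0 s i - (i == p).
Proof. by rewrite nth_set_nth /=; case: eqP => [->|_]; rewrite ?subn0. Qed.

Lemma nth_strip_zeros s i : nth 0 (strip_zeros s) i = nth 0 s i.
Proof.
elim: s i => //= x s IH i; case: ifP => [/andP[/eqP-> /nilP s0]|_].
  by case: i => [|i] /=; rewrite -?IH ?s0 ?nth_nil.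
by case: i => [|i] /=.
Qed.

Lemma strip_zeros_pos s : (forall i, 0 < nth 0 s i.+1 -> 0 < nth 0 s i) ->
  0 \notin strip_zeros s.
Proof.
elim: s => //= x s IH down; have {}IH := IH (fun i => down i.+1).
case: ifP => //; rewrite inE negb_or IH andbT eq_sym.
case: eqP => // x0 /=; have := nth_strip_zeros s 0.
case: (strip_zeros s) IH => //= y u; rewrite inE eq_sym negb_or -lt0n.
by move=> /andP[y0 _] yE; have := down 0; rewrite -x0 -yE => /(_ y0).
Qed.

Lemma nth_gt0 s i : 0 \notin s -> (0 < nth 0 s i) = (i < size s).
Proof.
move=> s0; case: (ltnP i (size s)) => is_; last by rewrite (nth_default 0 is_).
by rewrite lt0n; apply: contraNneq s0 => <-; rewrite mem_nth.
Qed.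

Lemma nth_le_top s i : nth 0 s i <= top_val s.
Proof.
have max_mem (u : seq nat) : 0 < size u -> \max_(x <- u) x \in u.
  elim: u => // x [|y u] IH _; first by rewrite big_seq1 inE.
  by rewrite big_cons inE /maxn; case: ifP; rewrite ?eqxx // IH ?orbT.
case: (ltnP i (size s)) => is_; last by rewrite nth_default.
rewrite /top_val /top_pos nth_index; last first.
  by rewrite max_mem // (leq_ltn_trans _ is_).
by apply: (@leq_bigmax_seq _ s xpredT id); rewrite ?mem_nth.
Qed.

(** A step can destroy the order of the first w + 1 entries, so for these only the bound w is kept;
    the tail stays sorted and at most w. *)
Definition loop_inv (w : nat) (s : seq nat) : Prop :=
  [/\ w < size s, 0 \notin s, forall i, i <= w -> w <= nth 0 s i,
      nth 0 s w.+1 <= w & forall i j, w < i <= j -> nth 0 s j <= nth 0 s i].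

Lemma loop_inv_tail w s i : loop_inv w s -> w < i -> nth 0 s i <= w.
Proof.
by case=> _ _ _ sw dec wi; apply: leq_trans sw; apply: dec; rewrite ltnSn.
Qed.

Lemma loop_inv_top w s : loop_inv w s -> w <= top_val s.
Proof. by case=> _ _ head _ _; apply: leq_trans (head 0 _) (nth_le_top _ _). Qed.

(** The top value exceeds w, so it sits among the first w + 1 entries, while the guard puts the last
    entry beyond them. The additive form avoids truncated subtraction. *)
Lemma topright_bodyE w s : loop_inv w s -> topright_guard w s ->
  [/\ top_pos s <= w, w < (size s).-1 &
      forall i, nth 0 s i = nth 0 (topright_body s) i
                            + (i == top_pos s) + (i == (size s).-1)].
Proof.
move=> inv /andP[ts wt].
have tw : top_pos s <= w.
  by rewrite leqNgt; apply: contraTN wt => /(loop_inv_tail inv); rewrite leqNgt.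
have wr : w < (size s).-1 by apply: leq_trans wt _; rewrite -subn1.
split=> // i; rewrite nth_strip_zeros !nth_decr /right_pos.
have [_ s0 _ _ _] := inv.
have rpos : 0 < nth 0 s (size s).-1 by rewrite nth_gt0 //; lia.
have tpos : 0 < nth 0 s (top_pos s) by apply: leq_ltn_trans wt.
case: (eqVneq i (top_pos s)) => [it|_]; case: (eqVneq i (size s).-1) => [ir|_] /=;
  rewrite ?it ?ir; lia.
Qed.

Lemma loop_inv_body w s : 0 < w -> loop_inv w s -> topright_guard w s ->
  loop_inv w (topright_body s) /\
  (size s).-1 <= size (topright_body s) <= size s.
Proof.
move=> w0 inv guard; have [tw wr bodyE] := topright_bodyE inv guard.
have /andP[_ wt] := guard; rewrite /top_val in wt.
have [ws s0 head sw dec] := inv.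
set s' := topright_body s in bodyE *.
have head' i : i <= w -> w <= nth 0 s' i.
  move=> iw; have := head i iw; have := bodyE i.
  case: (eqVneq i (top_pos s)) => [->|_] /=; lia.
have le_body i : nth 0 s' i <= nth 0 s i by rewrite bodyE -addnA leq_addr.
have body_gt0 i : i < (size s).-1 -> 0 < nth 0 s' i.
  case: (leqP i w) => [/head' wi _|wi ir]; first exact: leq_trans wi.
  have := bodyE i; rewrite (ltn_eqF ir) gtn_eqF ?(leq_ltn_trans tw) // !addn0 => <-.
  by rewrite nth_gt0 // (leq_trans ir) // leq_pred.
have s'0 : 0 \notin s'.
  apply: strip_zeros_pos => i.
  rewrite -(nth_strip_zeros _ i.+1) -(nth_strip_zeros _ i) => pos.
  apply: body_gt0; rewrite -ltnS (ltn_predK ws) -nth_gt0 //.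
  exact: leq_trans (le_body _).
split; last first.
  apply/andP; split; last first.
    by rewrite leqNgt -nth_gt0 // -leqNgt (leq_trans (le_body _)) // nth_default.
  by case rE: (size s).-1 wr => [//|p] _; rewrite -nth_gt0 // body_gt0 // rE.
split=> //.
- by rewrite -nth_gt0 //; apply: leq_trans (head' w _).
- exact: leq_trans (le_body _) sw.
move=> i j wij; have /andP[wi ij] := wij.
have [-> //|ne_ij] := eqVneq j i; apply: leq_trans (le_body j) _.
have := bodyE i; rewrite [i == top_pos s]gtn_eqF ?(leq_ltn_trans tw) // addn0.
(* If i is the last position, the entry at j > i is the default 0. *)
have [ir _|_] := eqVneq i (size s).-1; last by rewrite addn0 => <-; apply: dec.
rewrite nth_default // -(ltn_predK ws) -ir ltn_neqAle eq_sym.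
by rewrite ne_ij.
Qed.

(** The form of (B_k) for k > w under the loop invariant: entries after the first w + 1 are at most
    w < k, so the minima disappear and the left sum may run over the whole sequence. *)
Definition cut_ineq s (k : nat) : Prop :=
  \sum_(0 <= i < size s) (nth 0 s i - k.-1) <= \sum_(k <= i < size s) nth 0 s i.

Lemma sum_nth_pad (F : nat -> nat) s m n : F 0 = 0 -> m <= size s <= n ->
  \sum_(m <= i < n) F (nth 0 s i) = \sum_(m <= i < size s) F (nth 0 s i).
Proof.
move=> F0 /andP[ms sn]; rewrite (big_cat_nat ms sn) /=.
rewrite [X in _ + X]big_nat_cond [X in _ + X]big1 ?addn0 // => i.
by rewrite andbT => /andP[/(nth_default 0)-> _].
Qed.

Lemma sum_pred1_nat (c : bool) m n a :
  \sum_(m <= i < n) (c && (i == a) : nat) = c && (m <= a < n).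
Proof.
have := big_nat1_eq addn (fun=> c : nat) a m n; rewrite big_mkcond /= => sumE.
rewrite (eq_bigr (fun i => if i == a then c : nat else 0)) ?sumE.
  by case: c {sumE}; case: ifP.
by move=> i _; case: eqP => _; rewrite ?andbT ?andbF.
Qed.

(** If the top is w, every excess over k - 1 vanishes. Otherwise stopping means that the top is at
    least |s|, and k = |s| fails: its right side is empty, its left side positive. *)
Lemma cut_ineq_stop w s : loop_inv w s -> ~~ topright_guard w s ->
  (top_val s == w) <-> (forall k, w < k <= size s -> cut_ineq s k).
Proof.
move=> inv guard; have le_wt := loop_inv_top inv.
have [ws s0 _ _ _] := inv; split=> [/eqP tw k /andP[wk _]|cut].
  rewrite /cut_ineq big1 // => i _; apply/eqP; rewrite subn_eq0.
  by apply: leq_trans (nth_le_top s i) _; rewrite tw -ltnS (ltn_predK wk).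
rewrite eqn_leq le_wt andbT leqNgt; apply: contraNN guard => wt.
rewrite /topright_guard wt andbT leqNgt; apply/negP => lt_st.
have := cut (size s); rewrite ws leqnn => /(_ isT); rewrite /cut_ineq.
rewrite [leqRHS]big_geq // leqn0 => /eqP sum0.
suff tp : top_pos s < size s.
  have := sum0; rewrite (bigD1_seq (top_pos s)) ?mem_index_iota ?iota_uniq //=.
  by rewrite -/(top_val s); lia.
by rewrite -nth_gt0 //; apply: leq_ltn_trans wt.
Qed.

(** For k above the top value the left side is 0. For k up to the top value, which is at most |s| -
    1, a step lowers both sides by exactly one. *)
Lemma cut_ineq_body w s : 0 < w -> loop_inv w s -> topright_guard w s ->
  (forall k, w < k <= size s -> cut_ineq s k) <->
  (forall k, w < k <= size (topright_body s) -> cut_ineq (topright_body s) k).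
Proof.
move=> w0 inv guard; have [tw wr bodyE] := topright_bodyE inv guard.
have [_ /andP[ss' s's]] := loop_inv_body w0 inv guard.
have /andP[ts wt] := guard.
set s' := topright_body s in bodyE ss' s's *.
have high k : top_val s < k -> \sum_(0 <= i < size s) (nth 0 s i - k.-1) = 0.
  by move=> tk; rewrite big1 // => i _; have := nth_le_top s i; lia.
(* The last entry is at most w <= k - 1 and never contributes, so only the decrement at the top
   matters. *)
have lhsE k : w < k -> \sum_(0 <= i < size s) (nth 0 s i - k.-1) =
    \sum_(0 <= i < size s') (nth 0 s' i - k.-1) + (k <= top_val s).
  move=> wk; rewrite -(@sum_nth_pad (subn^~ k.-1) s' 0 (size s)) ?sub0n //.
  have -> : (k <= top_val s) =
      (k <= top_val s) && (0 <= top_pos s < size s) by lia.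
  rewrite -(sum_pred1_nat (k <= top_val s)) -big_split; apply: eq_bigr => i _ /=.
  have := bodyE i; have := @loop_inv_tail w s i inv.
  case: (eqVneq i (top_pos s)) => [->|_] /=; last by rewrite andbF; lia.
  rewrite -/(top_val s); case: (eqVneq (top_pos s) (size s).-1); lia.
have rhsE k : w < k <= size s' -> \sum_(k <= i < size s) nth 0 s i =
    \sum_(k <= i < size s') nth 0 s' i + (k < size s).
  move=> /andP[wk ks']; rewrite -(@sum_nth_pad id s' k (size s)) ?ks' //.
  have -> : (k < size s) = true && (k <= (size s).-1 < size s) by lia.
  rewrite -(sum_pred1_nat true) -big_split; apply: eq_big_nat => i /andP[ki _] /=.
  by rewrite bodyE (_ : (i == top_pos s) = false) ?addn0 //; lia.
split=> cut k /andP[wk ks]; rewrite /cut_ineq.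
  have := cut k; rewrite /cut_ineq wk (leq_trans ks) // => /(_ isT).
  have := high k; rewrite lhsE // rhsE ?wk //; lia.
case: (ltnP (top_val s) k) => [/high->//|kt].
have ks' : k <= size s' by lia.
have := cut k; rewrite wk ks' => /(_ isT); rewrite /cut_ineq lhsE // rhsE ?wk //.
lia.
Qed.

Lemma cut_ineq_of_loop w s b : 0 < w -> topright_loop w s b -> b ->
  loop_inv w s -> forall k, w < k <= size s -> cut_ineq s k.
Proof.
move=> w0; elim=> {s b} [s guard tw|s b guard _ IH bT] inv.
  by apply/(cut_ineq_stop inv guard).
by apply/(cut_ineq_body w0 inv guard)/IH => //; case: (loop_inv_body w0 inv guard).
Qed.

(** * From inequalities to runs and from runs to graphs *)

Lemma sumn_nth s : sumn s = \sum_(0 <= i < size s) nth 0 s i.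
Proof. by rewrite sumnE (big_nth 0). Qed.

Lemma sum_body w s : 0 < w -> loop_inv w s -> topright_guard w s ->
  sumn s = (sumn (topright_body s)).+2.
Proof.
move=> w0 inv guard; have [tw wr bodyE] := topright_bodyE inv guard.
have [_ /andP[_ s's]] := loop_inv_body w0 inv guard.
rewrite !sumn_nth -(@sum_nth_pad id (topright_body s) 0 (size s)) //.
rewrite (eq_bigr _ (fun i _ => bodyE i)) !big_split /= -addn2 -addnA.
by congr (_ + _); rewrite (sum_pred1_nat true) (sum_pred1_nat true) /=; lia.
Qed.

(** Each step lowers the sum by two and keeps the inequalities, so the loop stops, and then with top
    value w. *)
Lemma loop_of_cut_ineq w s : 0 < w -> loop_inv w s ->
  (forall k, w < k <= size s -> cut_ineq s k) -> topright_loop w s true.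
Proof.
move=> w0; have [m] := ubnP (sumn s).
elim: m s => // m IH s sm inv cut; have [guard|guard] := boolP (topright_guard w s).
  apply: TopRightIter => //; apply: IH.
  - by move: sm; rewrite (sum_body w0 inv guard); lia.
  - by case: (loop_inv_body w0 inv guard).
  - exact/(cut_ineq_body w0 inv guard).
have -> : true = (top_val s == w) by apply/esym/(cut_ineq_stop inv guard).
exact: TopRightStop.
Qed.

(** The run is undone on a fixed set of N vertices: entries stripped by the loop become vertices of
    degree 0. *)
Lemma realizable_of_loop N w s b : 0 < w -> topright_loop w s b -> b ->
    loop_inv w s -> ~~ odd (sumn s) -> size s <= N ->
  realizable (fun i : 'I_N => nth 0 s i).
Proof.
move=> w0; elim=> {s b} [s guard /eqP tw|s b guard _ IH bT] inv ev sN.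
  have [ws s0 head sw _] := inv.
  have wN := leq_trans ws sN.
  have widen_inj : injective (widen_ord wN) by move=> i j [/val_inj].
  apply: (@realizable_saturated _ [set widen_ord wN i | i : 'I_w.+1] w).
  - by rewrite card_imset // card_ord.
  - move=> x /imsetP[i _ ->] /=; have /head wi : i <= w by rewrite -ltnS.
    by apply/eqP; rewrite eqn_leq wi andbT -[leqRHS]tw nth_le_top.
  - by move=> x; rewrite -[leqRHS]tw nth_le_top.
  rewrite -(big_mkord xpredT (nth 0 s)) (@sum_nth_pad id s 0 N) //.
  by rewrite -sumn_nth.
have [tw wr bodyE] := topright_bodyE inv guard.
have [inv' /andP[_ s's]] := loop_inv_body w0 inv guard.
have [ws s0 head sw dec] := inv.
have rs : (size s).-1 < size s by rewrite (ltn_predK ws).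
have tN : top_pos s < N by apply: leq_trans sN; apply: leq_ltn_trans ws.
have rN : (size s).-1 < N by apply: leq_trans sN.
apply: (@realizable_top_right _ _ (fun i : 'I_N => nth 0 (topright_body s) i)
  (Ordinal tN) (Ordinal rN)).
- by rewrite -val_eqE /= ltn_eqF // (leq_ltn_trans tw).
- have widen_inj : injective (widen_ord sN) by move=> i j [/val_inj].
  have /andP[ts _] := guard; apply: (@leq_trans (size s)).
    by rewrite -(ltn_predK ws) ltnS -subn1.
  rewrite -[leqLHS](card_ord (size s)).
  rewrite -(card_imset _ widen_inj); apply: subset_leq_card.
  by apply/subsetP => x /imsetP[i _ ->]; rewrite inE /= nth_gt0.
- move=> x; rewrite nth_gt0 // => xs /=; have [xw|wx] := leqP x w.
    exact: leq_trans (loop_inv_tail inv wr) (head x xw).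
  by apply: dec; rewrite wx -ltnS (ltn_predK ws).
- by move=> x; rewrite bodyE -!val_eqE.
apply: IH => //; last exact: leq_trans s's sN.
by move: ev; rewrite (sum_body w0 inv guard) /= negbK.
Qed.

(** * Right weak indices *)

Lemma graphic_of_realizable (D : seq nat) :
  realizable (fun i : 'I_(size D) => nth 0 D i) -> graphic D.
Proof.
move=> [e [es eD]]; exists 'I_(size D), e; split=> //.
rewrite /image_mem (eq_map eD).
rewrite -[X in perm_eq _ X](mkseq_nth 0) /mkseq -val_enum_ord.
by rewrite -map_comp.
Qed.

Lemma nth_nonincr (D : seq nat) i j : sorted geq D -> i <= j ->
  nth 0 D j <= nth 0 D i.
Proof.
move=> sD ij; have [jD|Dj] := ltnP j (size D); last by rewrite nth_default.
apply: (sorted_leq_nth (leT := geq)) => //; rewrite ?inE //.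
- by move=> x y z /= xy yz; apply: leq_trans yz xy.
- exact: leqnn.
exact: leq_ltn_trans jD.
Qed.

Lemma min_weak_inv (D : seq nat) :
    sorted geq D -> all (fun d => 0 < d) D -> dseq D (size D) < size D - 1 ->
  0 < min_weak D /\ loop_inv (min_weak D) D.
Proof.
move=> sD posD lastD; rewrite /min_weak; case: ex_minnP => w.
rewrite /dseq addn2 => /andP[w0 ww] wmin; split=> //.
have D0 : 0 \notin D by apply: contraTN posD => D0; apply/allPn; exists 0.
have gt0 i := nth_gt0 i D0.
(* As d_n <= n - 2, the index n - 2 is weak, whence w <= n - 2. *)
have ws : w < (size D).-1.
  have := wmin (size D - 2); rewrite addn2 /=; have := gt0 (size D).-1.
  move: lastD; rewrite /dseq.
  case: (size D) => [|[|n]] //=; rewrite !subSS !subn0.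
  by rewrite ltnSn; case: n => [|n] /=; lia.
have wD : w < size D by apply: leq_trans ws (leq_pred _).
split=> //.
  (* Minimality excludes w - 1, so d_{w+1} >= w; for w = 1 this is positivity of d_2. *)
  move=> i iw; apply: leq_trans (nth_nonincr sD iw).
  have := wmin w.-1; have := gt0 w; rewrite addn2 /=.
  by case: w w0 {ww wmin iw ws} wD => [|[|w]] //=; lia.
by move=> i j /andP[_]; apply: nth_nonincr.
Qed.

Lemma cut_ineqP (D : seq nat) w k : loop_inv w D -> w < k <= size D ->
  ineqB D k <-> cut_ineq D k.
Proof.
move=> inv /andP[wk kD]; rewrite ineqBE // /cut_ineq.
have tail i : k <= i -> nth 0 D i < k.
  by move=> ki; apply: leq_ltn_trans (loop_inv_tail inv (leq_trans wk ki)) wk.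
have -> : \sum_(0 <= i < size D) (nth 0 D i - k.-1) =
          \sum_(0 <= i < k) (nth 0 D i - k.-1).
  rewrite (big_cat_nat (leq0n k) kD) /= [X in _ + X]big_nat_cond.
  rewrite [X in _ + X]big1 ?addn0 // => i /andP[/andP[ki _] _].
  by have := tail i ki; lia.
have -> // : \sum_(k <= i < size D) minn (nth 0 D i) k =
             \sum_(k <= i < size D) nth 0 D i.
by apply: eq_big_nat => i /andP[ki _]; apply/minn_idPl/ltnW/tail.
Qed.

(* Moving from k to k + 1 lowers the left side of the inequality by
   c_k = #{i | k <= d_i} and the right side by d_{k+1}.  As c is nonincreasing, a
   failure that appears while d is constant persists to the end of that run,
   which is a right weak index. *)
Lemma cut_ineq_right_weak (D : seq nat) w : 0 < w -> loop_inv w D ->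
    sorted geq D ->
    cut_ineq D w.+1 ->
    (forall k, w < k -> right_weak_index D k -> cut_ineq D k) ->
  forall k, w < k <= size D -> cut_ineq D k.
Proof.
move=> w0 inv sD cut_w cut_rw; have [_ D0 _ _ _] := inv.
(* Positions count from 0 here: [d k] is d_{k+1}. *)
pose n := size D; pose d i := nth 0 D i.
pose L k := \sum_(0 <= i < n) (d i - k.-1).
pose R k := \sum_(k <= i < n) d i.
pose c k := \sum_(0 <= i < n) (k <= d i).
have LE k : 0 < k -> L k = L k.+1 + c k.
  by move=> k0; rewrite /L /c -big_split; apply: eq_bigr => i _ /=; lia.
have RE k : k < n -> R k = d k + R k.+1 by move=> kn; rewrite /R big_ltn.
have c_dec k : c k.+1 <= c k by apply: leq_sum => i _; lia.
have bad k : w < k < n -> R k.+1 < L k.+1 -> c k < d k -> False.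
  have [m] := ubnP (n - k); elim: m k => // m IH k nkm /andP[wk kn] RL cd.
  have [rw|] := boolP (right_weak_index D k.+1).
    by have := cut_rw k.+1 (ltnW wk) rw; rewrite /cut_ineq leqNgt RL.
  have tail : d k.+2 <= k.+1.
    by apply: leq_trans (loop_inv_tail inv _) (leqW (ltnW wk));
      rewrite !ltnS leqW // ltnW.
  rewrite /right_weak_index /weak_index /dseq addn2 addn1 /= kn tail /= -leqNgt.
  rewrite -/(d k) -/(d k.+1) => dk.
  (* Since d_{k+2} >= d_{k+1} > c_k >= 0, the constant run has not reached the end of D. *)
  have kn' : k.+1 < n by
    rewrite -nth_gt0 // (leq_trans _ dk) // (leq_ltn_trans _ cd).
  have cd' : c k.+1 < d k.+1 by apply: leq_ltn_trans (c_dec k) (leq_trans cd dk).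
  apply: (IH k.+1) => //; first by lia.
  - by rewrite kn' ltnW.
  - by have := LE k.+1 isT; have := RE k.+1 kn'; lia.
elim=> // k IH /andP[wk kn]; have [<-//|ne_wk] := eqVneq w k.
have {ne_wk}wk : w < k by rewrite ltn_neqAle ne_wk -ltnS.
have := IH; rewrite wk ltnW // /cut_ineq -!/(L _) -!/(R _) => /(_ isT) LR.
(* Failure at k + 1 after success at k forces c_k < d_{k+1}. *)
rewrite leqNgt; apply/negP => RL; apply: (bad k) => //; first by rewrite wk.
by have := LE k (leq_trans w0 (ltnW wk)); have := RE k kn; lia.
Qed.

Theorem theorem4 (D : seq nat)
    (D_nonincr : sorted geq D)
    (D_pos : all (fun d => 0 < d) D)
    (D_even : ~~ odd (sumn D))
    (D_last : dseq D (size D) < size D - 1) :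
  [<-> graphic D;
       forall k, min_weak D + 1 <= k <= size D -> ineqB D k;
       topright_returns D true;
       ineqB D (min_weak D + 1) /\ forall k, right_weak_index D k -> ineqB D k].
Proof.
have [w0 inv] := min_weak_inv D_nonincr D_pos D_last.
have [wD _ _ _ _] := inv.
have cutP k := cut_ineqP (k := k) inv.
have graphic_ineqB k : graphic D -> k <= size D -> ineqB D k.
  by move=> gD kD; apply/ineqBE => //; apply: graphic_sum_excess.
have loop_graphic : topright_returns D true -> graphic D.
  move=> run; apply: graphic_of_realizable.
  exact: (realizable_of_loop w0 run).
have cut_loop : (forall k, min_weak D < k <= size D -> cut_ineq D k) ->
    topright_returns D true by exact: loop_of_cut_ineq.
(* The cycle is (1), (2), (3), (4), (1); its last arrow first recovers all inequalities and then a
   successful run. *)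
rewrite !addn1; tfae.
- by move=> gD k /andP[_ kD]; apply: graphic_ineqB.
- by move=> ineq; apply: cut_loop => k wk; apply/cutP => //; apply: ineq.
- move=> /loop_graphic gD; split=> [|k /andP[/andP[/andP[_ kD] _] _]];
    exact: graphic_ineqB.
move=> [ineq_w ineq_rw]; apply/loop_graphic/cut_loop.
apply: cut_ineq_right_weak => // [|k wk rwk].
  by apply/cutP => //; rewrite ltnSn.
have /andP[/andP[/andP[_ kD] _] _] := rwk.
by apply/cutP; [rewrite wk | apply: ineq_rw].
Qed.
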